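(* Let $S\subset\mathbb{R}^2$ be a plane convex body and let $k$ be any natural number. Then $S$ can be cut into $2^k$ convex pieces of equal area (i.e., $S$ is the union of $2^k$ compact convex sets with pairwise disjoint interiors, all having the same area), each of which has roundness at least $\min\left(C(S),\tfrac1{12}\right)$, where $C(S)$ denotes the roundness of $S$.
   Context: A plane convex body is a compact convex subset of $\mathbb{R}^2$ with nonempty interior. $d(\cdot,\cdot)$ is Euclidean distance. Roundness: let $S$ be a compact convex set in the plane consisting of more than one point. For distinct points $p,q\in S$, let $rs$ be the (possibly degenerate) segment that is the intersection of $S$ with the orthogonal bisector of the segment $pq$, and put $C(S,p,q):=\frac{d(r,s)}{d(p,q)}$. The roundness of $S$ is $C(S):=\inf_{p,q}C(S,p,q)$, the infimum being over all pairs of distinct points $p,q\in S$. *)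

(* Defs.v *)
From mathcomp Require Import all_boot all_order all_algebra.
From mathcomp Require Import all_classical all_reals all_analysis.

Set Implicit Arguments.
Unset Strict Implicit.
Unset Printing Implicit Defensive.

Import Order.TTheory GRing.Theory Num.Theory.
Import numFieldNormedType.Exports.

Local Open Scope classical_set_scope.
Local Open Scope ring_scope.

(* The plane is [R * R].  Its library norm is the sup norm: this gives the usual
   topology, but distances have to be measured with [edist]. *)
Definition edist (R : realType) (x y : R * R) : R :=
  Num.sqrt ((x.1 - y.1) ^+ 2 + (x.2 - y.2) ^+ 2).

Definition area (R : realType) (A : set (R * R)) : \bar R :=
  ((@lebesgue_measure R) \x (@lebesgue_measure R))%E A.

Definition segment (R : realType) (r s : R * R) : set (R * R) :=
  [set (1 - t) *: r + t *: s | t in `[0, 1]].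

Definition midpoint (R : realType) (p q : R * R) : R * R := 2^-1 *: (p + q).

Definition orthogonal_bisector (R : realType) (p q : R * R) : set (R * R) :=
  let m := midpoint p q in
  [set x | (x.1 - m.1) * (q.1 - p.1) + (x.2 - m.2) * (q.2 - p.2) = 0].

(* When S is compact and convex and p, q are distinct points of S,
   [S `&` orthogonal_bisector p q] is a possibly degenerate segment rs whose
   endpoints are unique up to order, so exactly one c satisfies
   [chord_ratio S p q c]. *)
Definition chord_ratio (R : realType) (S : set (R * R)) (p q : R * R) (c : R)
    : Prop :=
  exists r s, S `&` orthogonal_bisector p q = segment r s /\
              c = edist r s / edist p q.

(* Meaningful for a compact convex S with more than one point: the set below is
   then nonempty and bounded below by 0. *)
Definition roundness (R : realType) (S : set (R * R)) : R :=
  inf [set c | exists p q, [/\ S p, S q, p <> q & chord_ratio S p q c]].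

Definition plane_convex_body (R : realType) (S : set (R * R)) : Prop :=
  [/\ compact S, convex_set S & interior S !=set0].

Definition equal_area_convex_pieces (R : realType) (n : nat) (S : set (R * R))
    (P : 'I_n -> set (R * R)) : Prop :=
  [/\ S = \bigcup_i P i,
      forall i, compact (P i) /\ convex_set (P i),
      trivIset setT (fun i => interior (P i)) &
      forall i j, area (P i) = area (P j)].

(* Main.v *)
Require Import Defs.
From mathcomp Require Import all_boot all_order all_algebra.
From mathcomp Require Import all_classical all_reals all_analysis.
From mathcomp Require Import measurable_realfun.
From mathcomp Require Import ring lra zify.

(* It suffices to bisect a body S once and to iterate.  Cut S perpendicularly to
   the coordinate axis along which its extent X is larger, at the line l that
   halves the area.  The homothety of ratio 3/4 centred at an extreme point b of
   S in this direction maps S into the part of S at distance at least X/4 from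
   the opposite extreme point a, and (3/4)^2 > 1/2, so l is at distance at least
   X/4 from both a and b.  Let A be the piece containing a, let p, q be points
   of A, and let m be their bisector.  If the chord of S along m lies in A, it
   is also the chord of A.  Otherwise m meets l inside S at some z, and meets the
   segment from a to one of p, q, say w, at a point r of A.  Since w is at
   distance |pq|/2 from m, |wr|/|wa| >= |pq|/(2|wa|), so that r is at distance
   at least (X/4)|pq|/(2|wa|) from l, and |wa| <= sqrt 2 X <= 3X/2 gives
   |rz| >= |pq|/12. *)

Import Order.TTheory GRing.Theory Num.Theory.
Import numFieldNormedType.Exports.

Local Open Scope classical_set_scope.
Local Open Scope ring_scope.

(* MathComp-Analysis has another [edist]. *)
Local Notation edist := Defs.edist.

(** * Measurability of open, closed and compact plane sets *)

Local Notation mplane R := (measurableTypeR R * measurableTypeR R)%type.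

(** An open set is the union of the boxes inside it that have a rational centre and a radius
    1/(n+1), and there are only countably many of these. *)
Lemma open_measurable_plane (R : realType)
    (U : set (mplane R)) :
  open (U : set (R * R)) -> measurable U.
Proof.
move=> oU.
pose box (i : rat * rat * nat) : set (mplane R) :=
  ball (ratr i.1.1 : R) i.2.+1%:R^-1 `*` ball (ratr i.1.2 : R) i.2.+1%:R^-1.
have -> : U = \bigcup_(i in [set i | box i `<=` U]) box i.
  apply/seteqP; split => [[x y] Uxy|z [i iU iz]]; last exact: iU.
  have /nbhs_ballP[e /= e0 eU] : nbhs ((x, y) : R * R) U.
    by move: oU; rewrite openE => /(_ _ Uxy).
  (* A radius below [e / 2] keeps a box whose centre is within that radius of [(x, y)] inside the
     [e]-ball. *)
  have [n _ /(_ n (leqnn _))/= ne] :=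
    near_infty_natSinv_lt (PosNum (divr_gt0 e0 (ltr0Sn R 1))).
  have rat_near (a : R) : exists q : rat, `|a - ratr q| < n.+1%:R^-1.
    have [|q] := @rat_in_itvoo R (a - n.+1%:R^-1) a.
      by rewrite gtrDl oppr_lt0 invr_gt0 ltr0n.
    rewrite in_itv/= => /andP[q1 q2]; exists q.
    by rewrite ger0_norm ?subr_ge0 ?(ltW q2)// ltrBlDr -ltrBlDl.
  have [qx xq] := rat_near x; have [qy yq] := rat_near y.
  exists (qx, qy, n); last by split; rewrite /= /ball/= distrC.
  have tri (a b c : R) : `|a - b| < n.+1%:R^-1 -> `|b - c| < n.+1%:R^-1 ->
      `|a - c| < e.
    move=> ab bc; rewrite (le_lt_trans (ler_distD b _ _))// (splitr e).
    by rewrite ltrD// (lt_trans _ ne).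
  move=> [u v] [/= ux vy]; apply: eU.
  by split; [exact: tri xq ux|exact: tri yq vy].
rewrite bigcup_mkcond; apply: countable_bigcupT_measurable => // i.
case: ifPn => // _.
by apply: measurableX; exact: measurable_ball.
Qed.

Lemma closed_measurable_plane (R : realType)
    (F : set (mplane R)) :
  closed (F : set (R * R)) -> measurable F.
Proof.
move=> cF; rewrite -[F]setCK; apply: measurableC; apply: open_measurable_plane.
by rewrite openC.
Qed.

Lemma compact_measurable_plane (R : realType)
    (S : set (mplane R)) :
  compact (S : set (R * R)) -> measurable S.
Proof.
move=> cS; apply: closed_measurable_plane.
by apply: compact_closed => //; exact: norm_hausdorff.
Qed.

(** * Behaviour of length and area under affine maps *)

Definition pushforward_measure {d1 d2} {T1 : measurableType d1}
    {T2 : measurableType d2} {R : realType} (m : {measure set T1 -> \bar R})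
    {f : T1 -> T2} (mf : measurable_fun setT f) : {measure set T2 -> \bar R} :=
  measure_function_pushforward__canonical__measure_function_Measure m mf.

Lemma measurable_affine (R : realType) (a b : R) :
  measurable_fun setT
    (fun x : measurableTypeR R => a * x + b : measurableTypeR R).
Proof. by apply: measurable_funD => //; exact: measurable_funM. Qed.

(** As a function of [A], the left side is a measure that gives []u, v]] the value [v - u]; Lebesgue
    measure is the only such measure. *)
Lemma lebesgue_measure_affine_preimage (R : realType) (a b : R) (A : set R) :
  0 < a -> measurable A ->
  (a%:E * @lebesgue_measure R ((fun x => a * x + b)%R @^-1` A) =
   @lebesgue_measure R A)%E.
Proof.
move=> a0 mA.
pose mu := mscale (NngNum (ltW a0))
  (pushforward_measure lebesgue_measure (measurable_affine R a b)).
apply/esym/(@lebesgue_measure_unique R mu) => //= _ [[u v]] _ <-.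
rewrite /mu /mscale/= /pushforward.
have -> : (fun x => a * x + b) @^-1` `]u, v]%classic =
          `](u - b) / a, (v - b) / a]%classic.
  by apply/seteqP; split => x; rewrite /= !in_itv/= ltr_pdivrMr//
    ler_pdivlMr// ltrBlDr lerBrDr mulrC.
rewrite !lebesgue_measure_itv/= !lte_fin ltr_pM2r ?invr_gt0// ltrD2r.
case: ifPn => // _; last by rewrite mule0.
by rewrite -EFinM; congr EFin; field; rewrite gt_eqF.
Qed.

(** The left side is a measure in [A] that agrees with the product measure on rectangles, by the
    one-dimensional case in each factor. *)
Lemma area_affine_preimage (R : realType) (a : R) (b : R * R)
    (A : set (mplane R)) :
  0 < a -> measurable A ->
  ((a ^+ 2)%:E * area ((fun x : R * R => a *: x + b)%R @^-1` A) = area A)%E.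
Proof.
move=> a0 mA.
pose f (x : mplane R) : mplane R := (a * x.1 + b.1, a * x.2 + b.2).
have mf : measurable_fun setT f.
  apply/measurable_fun_pairP; split => /=.
    exact: measurableT_comp (measurable_affine R a b.1) measurable_fst.
  exact: measurableT_comp (measurable_affine R a b.2) measurable_snd.
pose mu := mscale (NngNum (sqr_ge0 a))
  (pushforward_measure (lebesgue_measure \x lebesgue_measure)%E mf).
apply/esym/(@product_measure_unique _ _ _ _ R
  lebesgue_measure lebesgue_measure mu) => //= X Y mX mY.
have fXY : f @^-1` (X `*` Y) = ((fun x => a * x + b.1) @^-1` X) `*`
  ((fun x => a * x + b.2) @^-1` Y) by [].
have mpre c Z : measurable Z -> measurable ((fun x => a * x + c)%R @^-1` Z).
  by move=> mZ; rewrite -[X in measurable X]setTI; exact: measurable_affine.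
rewrite /mu /mscale/= /pushforward fXY product_measure1E//; [|exact: mpre..].
by rewrite expr2 EFinM muleACA !lebesgue_measure_affine_preimage.
Qed.

(** * Coordinates and closed half-planes *)

(** The boolean index lets a single argument treat horizontal and vertical cuts. *)
Definition coordinate {R : realType} (i : bool) (x : R * R) : R :=
  if i then x.2 else x.1.

Lemma continuous_coordinate (R : realType) (i : bool) :
  continuous (coordinate i : R * R -> R).
Proof. by case: i => x; [exact: cvg_snd|exact: cvg_fst]. Qed.

Lemma compact_coordinate_le (R : realType) (S : set (R * R)) (i : bool)
    (t : R) :
  compact S -> compact (S `&` [set x | coordinate i x <= t]).
Proof.
move=> cS; apply: compact_closedI => //.
exact: (closed_comp (fun x _ => @continuous_coordinate R i x) (@closed_le R t)).
Qed.

Lemma compact_coordinate_ge (R : realType) (S : set (R * R)) (i : bool)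
    (t : R) :
  compact S -> compact (S `&` [set x | t <= coordinate i x]).
Proof.
move=> cS; apply: compact_closedI => //.
exact: (closed_comp (fun x _ => @continuous_coordinate R i x) (@closed_ge R t)).
Qed.

Lemma compact_bounded_coordinate (R : realType) (S : set (R * R)) :
  compact S ->
  exists2 M : R, 0 <= M & forall i x, S x -> `|coordinate i x| <= M.
Proof.
move=> cS; have [M [Mreal SM]] := compact_bounded cS.
exists (`|M| + 1); first by rewrite addr_ge0.
move=> i x Sx; have := SM (`|M| + 1).
rewrite (le_lt_trans (ler_norm M)) ?ltrDl// => /(_ isT _ Sx).
by rewrite /Num.norm/= ge_max => /andP[]; case: i.
Qed.

(** * Area of compact sets *)

Section area.
Variable R : realType.
Implicit Types (S A B : set (R * R)).
Local Open Scope ereal_scope.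

Lemma le_area A B : compact A -> compact B -> A `<=` B -> area A <= area B.
Proof.
by move=> cA cB AB; apply: le_measure => //; rewrite inE;
  exact: compact_measurable_plane.
Qed.

Lemma area_setU_le A B : compact A -> compact B ->
  area (A `|` B) <= area A + area B.
Proof. by move=> cA cB; apply: measureU2; exact: compact_measurable_plane. Qed.

Lemma areaX (I J : set (measurableTypeR R)) : measurable I -> measurable J ->
  area (I `*` J) = lebesgue_measure I * lebesgue_measure J.
Proof. exact: product_measure1E. Qed.

(** The part of [S] in the strip lies in a rectangle with sides [v - u] and [2 * M]. This yields
    finiteness of areas, continuity of the area cut off by a moving line, and nullity of lines. *)
Lemma area_strip_le S (M u v : R) (i : bool) : compact S ->
  (forall i x, S x -> (`|coordinate i x| <= M)%R) -> (u <= v)%R -> (0 <= M)%R ->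
  area (S `&` [set x | (coordinate i x <= v)%R]
          `&` [set x | (u <= coordinate i x)%R]) <= ((v - u) * (2 * M))%:E.
Proof.
move=> cS SM uv M0.
pose I : set (measurableTypeR R) := `[u, v]%classic.
pose J : set (measurableTypeR R) := `[(- M)%R, M]%classic.
have mI : measurable I by exact: measurable_itv.
have mJ : measurable J by exact: measurable_itv.
have lI : lebesgue_measure I = (v - u)%:E.
  rewrite lebesgue_measure_itv/= lte_fin; case: ltP => // vu.
  by rewrite (_ : u = v) ?subrr//; apply/eqP; rewrite eq_le uv.
have lJ : lebesgue_measure J = (2 * M)%:E.
  rewrite lebesgue_measure_itv/= lte_fin; case: ltP => [_|MM]; last idtac.
    by congr EFin; ring.
  by congr EFin; apply: le_anti; lra.
have mS : measurable (S `&` [set x | (coordinate i x <= v)%R]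
   `&` [set x | (u <= coordinate i x)%R] : set (mplane R)).
  apply: compact_measurable_plane.
  exact/compact_coordinate_ge/compact_coordinate_le.
have SJ j x : S x -> J (coordinate j x).
  by move=> Sx; rewrite /J/= in_itv/= -ler_norml SM.
case: i mS => mS.
  apply: (@le_trans _ _ (area (J `*` I))).
    apply: le_measure; rewrite ?inE//; first exact: measurableX.
    move=> x [[Sx xv] xu]; split; first exact: (SJ false).
    by rewrite /I/= in_itv/=; apply/andP.
  by rewrite areaX// lI lJ -EFinM mulrC.
apply: (@le_trans _ _ (area (I `*` J))).
  apply: le_measure; rewrite ?inE//; first exact: measurableX.
  move=> x [[Sx xv] xu]; split; last exact: (SJ true).
  by rewrite /I/= in_itv/=; apply/andP.
by rewrite areaX// lI lJ -EFinM.
Qed.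

Lemma area_ge0 A : 0 <= area A.
Proof. exact: measure_ge0. Qed.

Lemma compact_area_fin_num A : compact A -> area A \is a fin_num.
Proof.
move=> cA; have [M M0 AM] := compact_bounded_coordinate _ _ cA.
rewrite ge0_fin_numE ?area_ge0//.
have := @area_strip_le A M (- M) M true cA AM (ge0_cp M0).2 M0.
move=> /le_lt_trans => /(_ +oo); rewrite ltry => /(_ isT).
apply: le_lt_trans; apply: le_area => //.
  exact/compact_coordinate_ge/compact_coordinate_le.
move=> x Ax; have := AM true x Ax.
by rewrite ler_norml => /andP[? ?].
Qed.

End area.

(** * Existence of a line that halves the area *)

(** The area below level [t] is Lipschitz in [t] by the bound on strips. The two area hypotheses
    place it at or below half at [lo] and at or above half at [hi], so the intermediate value
    theorem applies. *)
Lemma halving_cut (R : realType) (S : set (R * R)) (i : bool) (lo hi : R) :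
  compact S -> lo <= hi ->
  (area S <= 2%:E * area (S `&` [set x | (lo <= coordinate i x)%R]))%E ->
  (area S <= 2%:E * area (S `&` [set x | (coordinate i x <= hi)%R]))%E ->
  exists t, [/\ lo <= t <= hi,
    area (S `&` [set x | coordinate i x <= t]) =
    area (S `&` [set x | t <= coordinate i x]) &
    area S = (area (S `&` [set x | (coordinate i x <= t)%R]) +
              area (S `&` [set x | (t <= coordinate i x)%R]))%E].
Proof.
move=> cS lohi Slo Shi.
pose L t := S `&` [set x | coordinate i x <= t].
pose U t := S `&` [set x | t <= coordinate i x].
have cL t : compact (L t) by exact: compact_coordinate_le.
have cU t : compact (U t) by exact: compact_coordinate_ge.
have [G GE] : exists G : R -> R, forall t, area (L t) = (G t)%:E.
  exists (fun t => fine (area (L t))) => t.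
  by rewrite fineK// compact_area_fin_num.
have [H HE] : exists H : R -> R, forall t, area (U t) = (H t)%:E.
  exists (fun t => fine (area (U t))) => t.
  by rewrite fineK// compact_area_fin_num.
have [s SE] : exists s : R, area S = s%:E.
  by exists (fine (area S)); rewrite fineK// compact_area_fin_num.
have [M M0 SM] := compact_bounded_coordinate _ _ cS.
have le_G u v : u <= v -> G u <= G v.
  move=> uv; rewrite -lee_fin -!GE; apply: le_area => // x [Sx xu].
  by split => //; exact: le_trans uv.
have G_le u v : u <= v -> G v <= G u + (v - u) * (2 * M).
  move=> uv; rewrite -lee_fin EFinD -!GE.
  pose V := L v `&` [set x | u <= coordinate i x].
  have cV : compact V by exact: compact_coordinate_ge.
  apply: (@le_trans _ _ (area (L u `|` V))).
    apply: le_area => //; first exact: compactU.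
    move=> x [Sx xv]; have [xu|ux] := leP (coordinate i x) u; first by left.
    by right; split => //; exact: ltW.
  apply: (le_trans (area_setU_le _ _ _ _ _)) => //.
  by rewrite leeD2l// area_strip_le.
(* The two closed parts overlap only on the cutting line, in the null set [W]. *)
have GHS t : G t + H t = s.
  apply/le_anti/andP; split; last first.
    rewrite -lee_fin EFinD -GE -HE -SE.
    rewrite (le_trans _ (area_setU_le _ _ _ _ _))// le_area//.
      exact: compactU.
    by move=> x Sx; have [xt|/ltW xt] := leP (coordinate i x) t; [left|right].
  have mL : measurable (L t : set (mplane R)).
    exact: compact_measurable_plane.
  have mS : measurable (S : set (mplane R)).
    exact: compact_measurable_plane.
  have mD : measurable (S `\` L t : set (mplane R)).
    exact: measurableD.
  pose W := L t `&` [set x | t <= coordinate i x].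
  have SLD : area S = (area (L t) + area (S `\` L t))%E.
    rewrite /area -measureU//; last by rewrite setDIK.
    by rewrite setDUK// => x [].
  rewrite -lee_fin EFinD -GE -HE -SE SLD leeD2l//.
  apply: (@le_trans _ _ (area ((S `\` L t) `|` W))).
    apply: le_measure; rewrite ?inE.
    - exact: compact_measurable_plane.
    - apply: measurableU => //; apply: compact_measurable_plane.
      exact: compact_coordinate_ge.
    - move=> x [Sx tx]; have [xt|xt] := leP (coordinate i x) t; first by right.
      by left; split => // -[_ /=]; rewrite leNgt xt.
  apply: (@le_trans _ _ (area (S `\` L t) + area W)%E).
    apply: measureU2 => //; apply: compact_measurable_plane.
    exact: compact_coordinate_ge.
  have -> : area W = 0%E.
    apply/le_anti; rewrite measure_ge0 andbT.
    have := @area_strip_le R S M t t i cS SM (lexx t) M0.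
    by rewrite subrr mul0r.
  by rewrite adde0.
have cG : continuous G.
  have Glip u v : `|G u - G v| <= `|u - v| * (2 * M).
    wlog uv : u v / v <= u.
      move=> hw; have [uv|/ltW uv] := leP v u; first exact: hw.
      by rewrite distrC (distrC u); exact: hw.
    by rewrite !ger0_norm ?subr_ge0 ?le_G// lerBlDl; exact: G_le.
  move=> x; apply/cvgrPdist_lt => e e0.
  (* The added 1 makes the Lipschitz constant positive even if [M = 0], so that [e] can be divided
     by it. *)
  have K0 : 0 < 2 * M + 1 by lra.
  near=> y; apply: (le_lt_trans (Glip x y)).
  apply: (@le_lt_trans _ _ (`|x - y| * (2 * M + 1))).
    by rewrite ler_wpM2l// lerDl.
  rewrite -ltr_pdivlMr//; near: y.
  by apply/nbhs_ballP; exists (e / (2 * M + 1)); rewrite //= divr_gt0.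
have Glo : G lo <= s / 2.
  move: Slo; rewrite SE HE -EFinM lee_fin; have := GHS lo; lra.
have Ghi : s / 2 <= G hi.
  by move: Shi; rewrite SE GE -EFinM lee_fin; lra.
have [||t tlohi Gt] := @IVT R G lo hi (s / 2) lohi.
- exact: continuous_subspaceT.
- by rewrite ge_min Glo le_max Ghi orbT.
exists t; split; first by move: tlohi; rewrite in_itv.
  by rewrite GE HE; congr EFin; have := GHS t; lra.
by rewrite GE HE SE -EFinD GHS.
Unshelve. all: by end_near.
Qed.

(** * Euclidean distance, bisectors, chords and roundness *)

Section euclidean_plane.
Variable R : realType.
Implicit Types (x y z p q r s : R * R) (S A : set (R * R)).

Definition dot (x y : R * R) : R := x.1 * y.1 + x.2 * y.2.

Lemma euclidean_ge0 x y : 0 <= edist x y.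
Proof. exact: sqrtr_ge0. Qed.

Lemma euclidean_sqr x y : edist x y ^+ 2 = (x.1 - y.1) ^+ 2 + (x.2 - y.2) ^+ 2.
Proof. by rewrite sqr_sqrtr// addr_ge0 ?sqr_ge0. Qed.

Lemma euclidean_gt0 x y : x <> y -> 0 < edist x y.
Proof.
move=> xy; rewrite sqrtr_gt0 lt_neqAle addr_ge0 ?sqr_ge0// andbT eq_sym.
apply/eqP => /eqP; rewrite paddr_eq0 ?sqr_ge0// !sqrf_eq0 !subr_eq0.
move=> /andP[/eqP x1 /eqP x2]; apply: xy.
by rewrite (surjective_pairing x) (surjective_pairing y) x1 x2.
Qed.

Lemma euclideanC x y : edist x y = edist y x.
Proof. by rewrite /Defs.edist -(sqrrN (x.1 - _)) -(sqrrN (x.2 - _)) !opprB. Qed.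

Lemma coordinate_le_edist i x y :
  `|coordinate i x - coordinate i y| <= edist x y.
Proof.
rewrite -sqrtr_sqr ler_wsqrtr//.
by case: i; rewrite /= ?lerDl ?lerDr sqr_ge0.
Qed.

(** Cauchy-Schwarz: by Lagrange's identity the difference of the squares is the square of a
    determinant. *)
Lemma dot_le_edist x y p q :
  dot (x - y) (q - p) <= edist x y * edist p q.
Proof.
apply: (le_trans (ler_norm _)).
rewrite -ler_sqr ?nnegrE ?mulr_ge0 ?euclidean_ge0//.
rewrite exprMn !euclidean_sqr real_normK ?num_real// /dot/= -subr_ge0.
set u := x.1 - y.1; set v := x.2 - y.2.
rewrite (_ : _ - _ = (u * (q.2 - p.2) - v * (q.1 - p.1)) ^+ 2) ?sqr_ge0//.
by rewrite /u /v/=; ring.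
Qed.

(** Convexity is unfolded to the parametrization that [segment] uses. *)
Lemma convex_setE S : convex_set S <->
  forall x y (t : R), S x -> S y -> 0 <= t <= 1 -> S ((1 - t) *: x + t *: y).
Proof.
split=> [cS x y t Sx Sy /andP[t0 t1]|cS x y t].
  have := cS y x (Itv01 t0 t1); rewrite !inE => /(_ Sy Sx).
  by rewrite /conv/= addrC.
rewrite !inE => Sx Sy; rewrite /conv/= addrC.
by apply: cS => //; rewrite ge0 le1.
Qed.

Lemma midpoint_bisector p q : orthogonal_bisector p q (midpoint p q).
Proof. by rewrite /orthogonal_bisector/= !subrr !mul0r addr0. Qed.

Lemma bisector_conv p q x y (t : R) :
  orthogonal_bisector p q x -> orthogonal_bisector p q y ->
  orthogonal_bisector p q ((1 - t) *: x + t *: y).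
Proof.
rewrite /orthogonal_bisector; move: (midpoint p q) => m /= ex ey.
transitivity (
    (1 - t) * ((x.1 - m.1) * (q.1 - p.1) + (x.2 - m.2) * (q.2 - p.2)) +
    t * ((y.1 - m.1) * (q.1 - p.1) + (y.2 - m.2) * (q.2 - p.2))).
  by rewrite /GRing.scale/=; ring.
by rewrite ex ey !mulr0 addr0.
Qed.

Lemma compact_bisector S p q :
  compact S -> compact (S `&` orthogonal_bisector p q).
Proof.
move=> cS; apply: compact_closedI => //.
pose m := midpoint p q.
pose g (x : R * R) := (x.1 - m.1) * (q.1 - p.1) + (x.2 - m.2) * (q.2 - p.2).
have cg : continuous g.
  move=> x; apply: cvgD; apply: cvgM; try exact: cvg_cst;
    apply: cvgB; try exact: cvg_cst; [exact: cvg_fst|exact: cvg_snd].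
exact: (closed_comp (fun x _ => cg x) (@closed_eq R 0)).
Qed.

(** The endpoints are the points of the compact chord that minimize and maximize a linear form [g]
    taken along the direction of the bisector. *)
Lemma chord_is_segment S p q :
  compact S -> convex_set S -> S p -> S q -> p <> q ->
  exists r s, S `&` orthogonal_bisector p q = segment r s.
Proof.
move=> cS /convex_setE vS Sp Sq pq.
(* [g] is the scalar product with [q - p] turned by a right angle. *)
pose g (x : R * R) := x.1 * (p.2 - q.2) + x.2 * (q.1 - p.1).
have cg : continuous g.
  move=> x; apply: cvgD; apply: cvgM; try exact: cvg_cst.
    exact: cvg_fst.
  exact: cvg_snd.
set K := S `&` _.
have K0 : K !=set0.
  exists (midpoint p q); split; last exact: midpoint_bisector.
  have := vS p q (2^-1) Sp Sq; rewrite /midpoint scalerDr.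
  rewrite (_ : 1 - 2^-1 = 2^-1 :> R); last by field.
  by apply; lra.
have cK : compact K by exact: compact_bisector.
have [r /[!inE] Kr rmin] := compact_EVT_min K0 cK (continuous_subspaceT cg).
have [s /[!inE] Ks smax] := compact_EVT_max K0 cK (continuous_subspaceT cg).
(* along the bisector, [g] is an affine parameter *)
have g_inj x y : K x -> K y -> g x = g y -> x = y.
  move=> [_ +] [_ +]; rewrite /orthogonal_bisector.
  move: (midpoint p q) => m /= ex ey gxy.
  have N0 : (q.1 - p.1) ^+ 2 + (q.2 - p.2) ^+ 2 != 0.
    by rewrite -euclidean_sqr expf_neq0// gt_eqF// euclidean_gt0// => /esym.
  pose B z := (z.1 - m.1) * (q.1 - p.1) + (z.2 - m.2) * (q.2 - p.2).
  have {}ex : B x = 0 by []; have {}ey : B y = 0 by [].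
  (* The vector [x - y] is recovered from its scalar products with [q - p] and with the rotated
     vector, both of which vanish. *)
  have e1 : (x.1 - y.1) * ((q.1 - p.1) ^+ 2 + (q.2 - p.2) ^+ 2) = 0.
    transitivity ((q.1 - p.1) * (B x - B y) - (q.2 - p.2) * (g x - g y)).
      by rewrite /B /g; ring.
    by rewrite ex ey gxy !subrr !mulr0 subr0.
  have e2 : (x.2 - y.2) * ((q.1 - p.1) ^+ 2 + (q.2 - p.2) ^+ 2) = 0.
    transitivity ((q.2 - p.2) * (B x - B y) + (q.1 - p.1) * (g x - g y)).
      by rewrite /B /g; ring.
    by rewrite ex ey gxy !subrr !mulr0 addr0.
  move/eqP: e1; rewrite mulf_eq0 (negbTE N0) orbF subr_eq0 => /eqP x1.
  move/eqP: e2; rewrite mulf_eq0 (negbTE N0) orbF subr_eq0 => /eqP x2.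
  by rewrite (surjective_pairing x) (surjective_pairing y) x1 x2.
have vK x y (t : R) : K x -> K y -> 0 <= t <= 1 -> K ((1 - t) *: x + t *: y).
  by move=> [Sx Bx] [Sy By] t01; split; [exact: vS|exact: bisector_conv].
have g_conv x y (t : R) : g ((1 - t) *: x + t *: y) = (1 - t) * g x + t * g y.
  by rewrite /g /= /GRing.scale/=; ring.
exists r, s; apply/seteqP; split=> [x Kx|_ [t t01 <-]]; last first.
  by apply: vK => //; move: t01; rewrite /= in_itv.
have grx : g r <= g x by apply: rmin; rewrite inE.
have gxs : g x <= g s by apply: smax; rewrite inE.
(* If the chord is a single point, the quotient defining the parameter degenerates and the parameter
   0 is used. *)
have [grs|grs] := eqVneq (g r) (g s).
  exists 0; first by rewrite /= in_itv/= lexx ler01.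
  rewrite subr0 scale1r scale0r addr0; apply: g_inj => //.
  by apply/le_anti; rewrite grx/= grs.
have grs0 : 0 < g s - g r by rewrite subr_gt0 lt_neqAle grs (le_trans grx).
have t01 : 0 <= (g x - g r) / (g s - g r) <= 1.
  by rewrite ler_pdivlMr// mul0r subr_ge0 grx ler_pdivrMr// mul1r lerD2r.
exists ((g x - g r) / (g s - g r)); first by rewrite /= in_itv.
apply: g_inj => //; first exact: vK.
by rewrite g_conv; field; rewrite gt_eqF.
Qed.

(** The vector [x - y] is a multiple of [r - s] by a factor of absolute value at most 1. Hence any
    two points of a chord bound its length from below. *)
Lemma euclidean_le_segment r s x y :
  segment r s x -> segment r s y -> edist x y <= edist r s.
Proof.
move=> [t + <-] [u + <-]; rewrite /= !in_itv/= => /andP[t0 t1] /andP[u0 u1].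
rewrite -ler_sqr ?nnegrE ?euclidean_ge0// !euclidean_sqr /GRing.scale/=.
rewrite (_ : _ + _ = (t - u) ^+ 2 * ((r.1 - s.1) ^+ 2 + (r.2 - s.2) ^+ 2)).
  by apply: ler_piMl; [rewrite addr_ge0 ?sqr_ge0|nra].
by rewrite /GRing.scale/=; ring.
Qed.

Lemma chord_ratio_exists S p q :
  compact S -> convex_set S -> S p -> S q -> p <> q ->
  exists c, chord_ratio S p q c.
Proof.
move=> cS vS Sp Sq pq; have [r [s rs]] := chord_is_segment _ _ _ cS vS Sp Sq pq.
by exists (edist r s / edist p q), r, s.
Qed.

Lemma roundness_le S p q c : S p -> S q -> p <> q -> chord_ratio S p q c ->
  roundness S <= c.
Proof.
move=> Sp Sq pq Sc; apply: ge_inf; last by exists p, q.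
exists 0 => _ [p' [q' [_ _ _ [r [s [_ ->]]]]]].
by rewrite divr_ge0 ?euclidean_ge0.
Qed.

(** The pair [p], [q] makes the set of ratios nonempty, so that a lower bound passes to its
    infimum. *)
Lemma le_roundness S p q (m : R) :
  compact S -> convex_set S -> S p -> S q -> p <> q ->
  (forall p q c, S p -> S q -> p <> q -> chord_ratio S p q c -> m <= c) ->
  m <= roundness S.
Proof.
move=> cS vS Sp Sq pq Sm; apply: lb_le_inf.
  by have [c Sc] := chord_ratio_exists _ _ _ cS vS Sp Sq pq; exists c, p, q.
by move=> c [p' [q' [Sp' Sq' pq' Sc]]]; exact: (Sm p' q').
Qed.

End euclidean_plane.

(** * Roundness of one side of a cut *)

(** Here [h] stands for the signed distance to the cutting line, negative on the side of [a]. Only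
    its being affine and 1-Lipschitz enters, so the lemma serves both pieces and both axes. The
    factor 6 in the last hypothesis is what becomes 1/12. *)
Lemma le_roundness_cut (R : realType) (S A : set (R * R)) (h : R * R -> R)
    (a b : R * R) :
  (forall x y t, h ((1 - t) *: x + t *: y) = (1 - t) * h x + t * h y) ->
  (forall x y, h x - h y <= edist x y) ->
  convex_set S -> A = S `&` [set x | h x <= 0] -> compact A -> convex_set A ->
  S a -> S b -> 0 <= h b -> h a < 0 ->
  (forall p, S p -> edist a p <= 6 * - h a) ->
  Num.min (roundness S) (1 / 12) <= roundness A.
Proof.
move=> h_conv h_lip vS AE cA vA Sa Sb hb ha far.
have S_conv := (convex_setE _ _).1 vS; have A_conv := (convex_setE _ _).1 vA.
have crossing x y : S x -> h x <= 0 -> S y -> 0 < h y ->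
    exists2 t, 0 <= t <= 1 & h ((1 - t) *: x + t *: y) = 0.
  move=> Sx hx Sy hy; have d0 : 0 < h y - h x by lra.
  exists (- h x / (h y - h x)).
    by rewrite ler_pdivlMr// mul0r ler_pdivrMr// mul1r; apply/andP; split; lra.
  by rewrite h_conv; field; rewrite gt_eqF.
have Aa : A a by rewrite AE; split => //=; exact: ltW.
(* A second point of [A] is [b] itself if it lies on the line, and otherwise the point where [ab]
   crosses the line. *)
have [c Ac ac] : exists2 c, A c & a <> c.
  move: hb; rewrite le_eqVlt => /predU1P[hb|hb].
    exists b; first by rewrite AE; split => //=; rewrite -hb.
    by move=> ab; move: ha; rewrite ab -hb ltxx.
  have [t t01 ht] := crossing a b Sa (ltW ha) Sb hb.
  exists ((1 - t) *: a + t *: b).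
    by rewrite AE; split; [exact: S_conv|rewrite /= ht].
  by move=> ac; move: ha; rewrite ac ht ltxx.
apply: (@le_roundness R A a c) => // p q k Ap Aq pq Ak.
have [Sp hp] : S p /\ h p <= 0 by move: Ap; rewrite AE.
have [Sq hq] : S q /\ h q <= 0 by move: Aq; rewrite AE.
(* If the bisector meets [S] only inside [A], then [A] and [S] have the same chord and the same
   ratio. *)
have [SA|] := pselect (S `&` orthogonal_bisector p q `<=` [set x | h x <= 0]).
  rewrite ge_min; apply/orP; left; apply: (@roundness_le R S p q) => //.
  move: Ak => [r [s [rs ->]]]; exists r, s; split => //.
  rewrite -rs AE; apply/seteqP; split=> [x SBx|x [[Sx _] Bx]] //.
  by have hx := SA _ SBx; case: SBx.
rewrite ge_min => /existsNP[y /not_implyP[[Sy By] /negP]].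
rewrite /= -ltNge => hy; apply/orP; right.
set m := midpoint p q.
have Bm : orthogonal_bisector p q m by exact: midpoint_bisector.
have Am : A m.
  have := A_conv p q 2^-1 Ap Aq; rewrite /m /midpoint scalerDr.
  by rewrite (_ : 1 - 2^-1 = 2^-1 :> R); [apply; lra|field].
have [Sm hm] : S m /\ h m <= 0 by move: Am; rewrite AE.
(* The bisector runs from the midpoint [m] in [A] to [y] beyond the line, hence crosses the line at
   a point [z] of [A]. *)
have [t t01 hz] := crossing m y Sm hm Sy hy.
set z := (1 - t) *: m + t *: y in hz.
have Az : A z by rewrite AE; split; [exact: S_conv|rewrite /= hz].
have Bz : orthogonal_bisector p q z by exact: bisector_conv.
pose N := edist p q; have N0 : 0 < N by exact: euclidean_gt0.
(* [g] is the signed distance to the bisector multiplied by [N]. *)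
pose g x := dot R (x - m) (q - p).
have g_conv x u s : g ((1 - s) *: x + s *: u) = (1 - s) * g x + s * g u.
  by rewrite /g /dot/= /GRing.scale/=; ring.
have gq : g q = N ^+ 2 / 2.
  by rewrite euclidean_sqr /g /dot/m /midpoint/= /GRing.scale/=; field.
have gp : g p = - (N ^+ 2 / 2).
  by rewrite euclidean_sqr /g /dot/m /midpoint/= /GRing.scale/=; field.
(* [w] is the endpoint of [pq] across the bisector from [a]; the bisector meets
   [aw] at [r], whose barycentric coordinate on [a] is at least
   [N / (2 * edist a w)]. *)
have [w [Aw [G [[GB GE] Ga Gw Gwa]]]] : exists w, A w /\ exists G : R * R -> R,
    [/\ (forall x, G x = 0 -> orthogonal_bisector p q x) /\
    (forall x u s, G ((1 - s) *: x + s *: u) = (1 - s) * G x + s * G u),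
    G a <= 0, G w = N ^+ 2 / 2 & G w - G a <= edist a w * N].
  have [ga|ga] := leP (g a) 0.
    exists q; split => //; exists g; split => //.
    have -> : g q - g a = dot R (q - a) (q - p) by rewrite /g /dot/=; ring.
    by rewrite (euclideanC _ a q) dot_le_edist.
  exists p; split => //; exists (fun x => - g x); split => //.
  - split=> [x /eqP|x u s]; last by rewrite g_conv; ring.
    by rewrite oppr_eq0 => /eqP.
  - lra.
  - by rewrite gp opprK.
  - have -> : - g p - - g a = dot R (a - p) (q - p) by rewrite /g /dot/=; ring.
    exact: dot_le_edist.
have [Sw hw] : S w /\ h w <= 0 by move: Aw; rewrite AE.
have N20 : 0 < N ^+ 2 / 2 by rewrite divr_gt0// exprn_gt0.
have D0 : 0 < G w - G a by lra.
have s01 : 0 <= - G a / (G w - G a) <= 1.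
  by rewrite ler_pdivlMr// mul0r ler_pdivrMr// mul1r; apply/andP; split; lra.
(* The parameter at which the affine function [G] vanishes on the segment from [a] to [w]. *)
set s := - G a / (G w - G a) in s01.
have sE : (1 - s) * (G w - G a) = G w by rewrite /s; field; rewrite gt_eqF.
set r := (1 - s) *: a + s *: w.
have Ar : A r by exact: A_conv.
have Br : orthogonal_bisector p q r.
  by apply: GB; rewrite GE /s; field; rewrite gt_eqF.
(* The contribution of [w] to [h r] is dropped because [h w <= 0]. *)
have hr : h r <= (1 - s) * h a.
  by rewrite h_conv gerDl; case/andP: s01 => ? ?; rewrite mulr_ge0_le0.
(* The chain is [N / 2 <= (1 - s) * edist a w <= 6 * (1 - s) * - h a <= 6 * - h r], with
   [h z = 0]. *)
have zr : N / 12 <= h z - h r.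
  have s1 : 0 <= 1 - s by lra.
  have : N / 2 <= (1 - s) * edist a w.
    by rewrite -(ler_pM2r N0) -mulrA; nra.
  have := far w Sw => aw /le_trans => /(_ ((1 - s) * (6 * - h a))).
  by rewrite hz ler_wpM2l// => /(_ isT); nra.
case: Ak => u [v [uv ->]].
rewrite ler_pdivlMr// mul1r.
apply: (@le_trans _ _ (edist z r)).
  by apply: le_trans (h_lip z r); rewrite mulrC -/N.
by apply: euclidean_le_segment; rewrite -uv.
Qed.

(** * Bisection of a body *)

Lemma coordinate_conv (R : realType) (i : bool) (x y : R * R) (t : R) :
  coordinate i ((1 - t) *: x + t *: y) =
  (1 - t) * coordinate i x + t * coordinate i y.
Proof. by case: i. Qed.

Lemma interior_half_planes_disjoint (R : realType) (i : bool) (t : R) :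
  interior [set x : R * R | coordinate i x <= t] `&`
  interior [set x : R * R | t <= coordinate i x] = set0.
Proof.
apply/seteqP; split => // x [/nbhs_ballP[e /= e0 eL] /interior_subset/= tx].
have d0 : 0 < e / 2 by rewrite divr_gt0.
(* A diagonal shift raises both coordinates, so it leaves the lower half-plane for either axis. *)
have xe : ball x e (x.1 + e / 2, x.2 + e / 2).
  have shift (u : R) : `|u - (u + e / 2)| < e.
    by rewrite opprD addNKr normrN gtr0_norm//; lra.
  by split; exact: shift.
by have := eL _ xe; case: i tx {eL} => /=; lra.
Qed.

Lemma compact_coordinate_range (R : realType) (S : set (R * R)) (i : bool) :
  compact S -> S !=set0 ->
  exists a, exists b, [/\ S a, S b &
    forall x, S x -> coordinate i a <= coordinate i x <= coordinate i b].
Proof.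
move=> cS S0; have cf := continuous_subspaceT (@continuous_coordinate R i).
have [a /[!inE] Sa amin] := compact_EVT_min S0 cS (cf S).
have [b /[!inE] Sb bmax] := compact_EVT_max S0 cS (cf S).
exists a, b; split => // x Sx.
by rewrite amin ?bmax ?inE.
Qed.

(** The homothety of ratio 3/4 centred at [b] maps [S] into [B] and multiplies areas by 9/16, which
    exceeds 1/2. *)
Lemma area_le_homothety (R : realType) (S B : set (R * R)) (b : R * R) :
  compact S -> compact B ->
  (forall x, S x -> B (3 / 4 *: x + 1 / 4 *: b)) ->
  (area S <= 2%:E * area B)%E.
Proof.
move=> cS cB SB.
have mB : measurable (B : set (mplane R)).
  exact: compact_measurable_plane.
have a0 : 0 < 3 / 4 :> R by lra.
have := area_affine_preimage R (3 / 4) (1 / 4 *: b) B a0 mB.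
set P := _ @^-1` B => PB.
have cP : closed (P : set (R * R)).
  apply: closed_comp.
    by move=> x _; apply: cvgD; [exact: scaler_continuous|exact: cvg_cst].
  by apply: compact_closed => //; exact: norm_hausdorff.
have mP : measurable (P : set (mplane R)).
  exact: closed_measurable_plane.
have SP : (area S <= area P)%E.
  by apply: le_measure; rewrite ?inE//; exact: compact_measurable_plane.
rewrite -PB muleA -EFinM; apply: (le_trans SP).
by rewrite -[leLHS]mul1e lee_wpmul2r ?area_ge0// lee_fin; lra.
Qed.

(** Choosing the axis of larger extent makes that extent bound the differences in both coordinates,
    and thereby the diameter. *)
Lemma wide_axis (R : realType) (S : set (R * R)) :
  compact S -> S !=set0 -> exists i, exists a, exists b, [/\ S a, S b,
    forall x, S x -> coordinate i a <= coordinate i x <= coordinate i b &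
    forall x y j, S x -> S y ->
      `|coordinate j x - coordinate j y| <= coordinate i b - coordinate i a].
Proof.
move=> cS S0.
have [a0 [b0 [Sa0 Sb0 r0]]] := compact_coordinate_range R S false cS S0.
have [a1 [b1 [Sa1 Sb1 r1]]] := compact_coordinate_range R S true cS S0.
have extent j a b :
    (forall x, S x -> coordinate j a <= coordinate j x <= coordinate j b) ->
    forall x y, S x -> S y ->
      `|coordinate j x - coordinate j y| <= coordinate j b - coordinate j a.
  move=> r x y /r/andP[? ?] /r/andP[? ?].
  by rewrite ler_norml; apply/andP; split; lra.
have n0 := extent _ _ _ r0; have n1 := extent _ _ _ r1.
have [le01|/ltW le10] := leP (coordinate false b0 - coordinate false a0)
                             (coordinate true b1 - coordinate true a1).
  exists true, a1, b1; split => // x y [] Sx Sy; first exact: n1.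
  exact: le_trans (n0 _ _ Sx Sy) le01.
exists false, a0, b0; split => // x y [] Sx Sy; last exact: n0.
exact: le_trans (n1 _ _ Sx Sy) le10.
Qed.

(** The rational constant 3/2 replaces the square root of 2, since 2 <= 9/4. *)
Lemma euclidean_le_square (R : realType) (x y : R * R) (X : R) :
  (forall j, `|coordinate j x - coordinate j y| <= X) -> edist x y <= 3 / 2 * X.
Proof.
move=> h; have X0 : 0 <= X by exact: le_trans (h true).
have Y0 : 0 <= 3 / 2 * X by lra.
rewrite -ler_sqr ?nnegrE ?euclidean_ge0// euclidean_sqr.
have sq j : (coordinate j x - coordinate j y) ^+ 2 <= X ^+ 2.
  by rewrite -(real_normK (num_real (_ - _))) ler_sqr ?nnegrE ?h.
have := sqr_ge0 X; have := sq false; have := sq true => /=.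
rewrite exprMn; set u := _ ^+ 2; set v := _ ^+ 2; set w := X ^+ 2; lra.
Qed.

Lemma bisection (R : realType) (S : set (R * R)) :
  compact S -> convex_set S -> (0 < area S)%E ->
  exists A B, [/\ S = A `|` B, compact A /\ convex_set A,
    compact B /\ convex_set B, interior A `&` interior B = set0 &
    [/\ area A = area B, area S = (area A + area B)%E,
      Num.min (roundness S) (1 / 12) <= roundness A &
      Num.min (roundness S) (1 / 12) <= roundness B]].
Proof.
move=> cS vS areaS.
have S0 : S !=set0.
  apply/set0P/eqP => SE; move: areaS.
  by rewrite SE /area measure0 ltxx.
have [i [a [b [Sa Sb Sab Sdiam]]]] := wide_axis R S cS S0.
set X := coordinate i b - coordinate i a in Sdiam.
(* With zero extent, [S] would lie on a line and have area 0. *)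
have X0 : 0 < X.
  have [M M0 SM] := compact_bounded_coordinate _ _ cS.
  have /andP[_ ab] := Sab a Sa.
  rewrite subr_gt0 lt_neqAle ab andbT; apply/eqP => abE.
  have := @area_strip_le R S M (coordinate i a) (coordinate i b) i cS SM ab M0.
  rewrite abE subrr mul0r leNgt => /negP; apply.
  apply: (lt_le_trans areaS); apply: le_area => //.
    exact/compact_coordinate_ge/compact_coordinate_le.
  by move=> x Sx; have := Sab x Sx; rewrite abE => /andP[bx xb].
have S_conv := (convex_setE _ _).1 vS.
have homothety y x : S y -> S x -> S (3 / 4 *: x + 1 / 4 *: y).
  move=> Sy Sx; have := S_conv x y (1 / 4) Sx Sy.
  rewrite (_ : 1 - 1 / 4 = 3 / 4 :> R); last by field.
  by apply; lra.
have coordinateE x y : coordinate i (3 / 4 *: x + 1 / 4 *: y) =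
    3 / 4 * coordinate i x + 1 / 4 * coordinate i y.
  by case: (i).
(* The homothety centred at [b] sends [S] to levels at least [coordinate i a + X / 4], and the one
   centred at [a] to levels at most [coordinate i b - X / 4]. *)
have [|||t [/andP[at_ tb]]] :=
  @halving_cut R S i (coordinate i a + X / 4) (coordinate i b - X / 4) cS.
- by rewrite /X; have := X0; rewrite /X; lra.
- apply: (@area_le_homothety R _ _ b) => //; first exact: compact_coordinate_ge.
  move=> x Sx; split; first exact: homothety.
  by rewrite /= coordinateE /X; have /andP[] := Sab x Sx; lra.
- apply: (@area_le_homothety R _ _ a) => //; first exact: compact_coordinate_le.
  move=> x Sx; split; first exact: homothety.
  by rewrite /= coordinateE /X; have /andP[] := Sab x Sx; lra.
set A := S `&` [set x | coordinate i x <= t].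
set B := S `&` [set x | t <= coordinate i x] => AB S2A.
have cA : compact A by exact: compact_coordinate_le.
have cB : compact B by exact: compact_coordinate_ge.
have vA : convex_set A.
  apply/convex_setE => x y u [Sx xt] [Sy yt] u01; split; first exact: S_conv.
  by move: xt yt; rewrite /= coordinate_conv; case/andP: u01; nra.
have vB : convex_set B.
  apply/convex_setE => x y u [Sx xt] [Sy yt] u01; split; first exact: S_conv.
  by move: xt yt; rewrite /= coordinate_conv; case/andP: u01; nra.
have SAB : S = A `|` B.
  apply/seteqP; split=> [x Sx|x [[]|[]]//].
  by have [xt|/ltW xt] := leP (coordinate i x) t; [left|right].
have far x y : S x -> S y -> edist x y <= 6 * (X / 4).
  move=> Sx Sy; rewrite (_ : 6 * _ = 3 / 2 * X); last by field.
  by apply: euclidean_le_square => j; exact: Sdiam.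
exists A, B; split => //; [|split => //].
- apply/seteqP; split => // x [Ax Bx].
  rewrite -(interior_half_planes_disjoint R i t); split.
    by move: Ax; apply: interiorS => y [].
  by move: Bx; apply: interiorS => y [].
- apply: (@le_roundness_cut R S A (fun x => coordinate i x - t) a b) => //.
  + by move=> x y u; rewrite coordinate_conv; ring.
  + move=> x y; rewrite (_ : _ - _ = coordinate i x - coordinate i y);
      last by ring.
    by rewrite (le_trans (ler_norm _)) ?coordinate_le_edist.
  + by apply/seteqP; split => x [Sx]; rewrite /= subr_le0.
  + by have := X0; lra.
  + by have := X0; lra.
  + by move=> p Sp; apply: (le_trans (far _ _ Sa Sp)); lra.
(* The other piece is the mirror image: the sign of [h] changes, and [a] and [b] exchange roles. *)
- apply: (@le_roundness_cut R S B (fun x => t - coordinate i x) b a) => //.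
  + by move=> x y u; rewrite coordinate_conv; ring.
  + move=> x y; rewrite (_ : _ - _ = coordinate i y - coordinate i x);
      last by ring.
    by rewrite euclideanC (le_trans (ler_norm _)) ?coordinate_le_edist.
  + by apply/seteqP; split => x [Sx]; rewrite /= subr_le0.
  + by have := X0; lra.
  + by have := X0; lra.
  + by move=> p Sp; apply: (le_trans (far _ _ Sb Sp)); lra.
Qed.

(** * Iteration of the bisection *)

(** Induction on [k], bisecting first and cutting both halves further. Indexing by natural numbers
    makes it easy to concatenate the two families, and positive area is the form of nondegeneracy
    that passes to the halves. *)
Lemma equal_area_cut (R : realType) (k : nat) (S : set (R * R)) :
  compact S -> convex_set S -> (0 < area S)%E ->
  exists P : nat -> set (R * R),
    [/\ S = \bigcup_(n in `I_(2 ^ k)) P n,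
      forall n, (n < 2 ^ k)%N -> compact (P n) /\ convex_set (P n),
      trivIset `I_(2 ^ k) (fun n => interior (P n)),
      forall n, (n < 2 ^ k)%N -> area S = ((2 ^+ k)%:E * area (P n))%E &
      forall n, (n < 2 ^ k)%N ->
        Num.min (roundness S) (1 / 12) <= roundness (P n)].
Proof.
elim: k S => [|k IH] S cS vS areaS.
  exists (fun=> S); split => //.
  - by apply/seteqP; split=> [x Sx|x [n _]//]; exists 0%N.
  - by move=> [|m] [|n].
  - by move=> n _; rewrite expr0 mul1e.
  - by move=> n _; rewrite ge_min lexx.
have [A [B [SAB [cA vA] [cB vB] AB0 [AB S2A rA rB]]]] :=
  bisection R S cS vS areaS.
have areaA : (0 < area A)%E.
  rewrite lt_neqAle area_ge0 andbT; apply/eqP => A0.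
  by move: areaS; rewrite S2A -AB -A0 adde0 ltxx.
have areaB : (0 < area B)%E by rewrite -AB.
have [P [AP cvP tP aP rP]] := IH A cA vA areaA.
have [Q [BQ cvQ tQ aQ rQ]] := IH B cB vB areaB.
have PA n : (n < 2 ^ k)%N -> P n `<=` A by move=> nk x Px; rewrite AP; exists n.
have QB n : (n < 2 ^ k)%N -> Q n `<=` B by move=> nk x Qx; rewrite BQ; exists n.
(* The first [2 ^ k] indices number the pieces of [A]; the next [2 ^ k], shifted back, number those
   of [B]. *)
pose F n := if (n < 2 ^ k)%N then P n else Q (n - 2 ^ k)%N.
have Flt n : (n < 2 ^ k)%N -> F n = P n by rewrite /F => ->.
have Fge n : (2 ^ k <= n)%N -> F n = Q (n - 2 ^ k)%N by rewrite /F ltnNge => ->.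
have E2 : (2 ^ k.+1 = 2 ^ k + 2 ^ k)%N by rewrite expnS mul2n addnn.
have sub_lt n : (n < 2 ^ k.+1)%N -> (2 ^ k <= n)%N -> (n - 2 ^ k < 2 ^ k)%N.
  by rewrite E2 => n1 n2; rewrite ltn_subLR.
have two_pow (a : \bar R) : (0 <= a)%E ->
    ((2 ^+ k.+1)%:E * a = (2 ^+ k)%:E * a + (2 ^+ k)%:E * a)%E.
  move=> a0; rewrite -ge0_muleDl ?lee_fin ?exprn_ge0//.
  by rewrite -EFinD exprS mulr2n mulrDl mul1r.
exists F; split.
- apply/seteqP; split=> [x|x [n /= nk]].
    rewrite {1}SAB => -[]; rewrite ?AP ?BQ => -[n /= nk Px].
      by exists n; [rewrite /= E2 ltn_addr|rewrite Flt].
    exists (2 ^ k + n)%N; first by rewrite /= E2 ltn_add2l.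
    by rewrite Fge ?leq_addr// addKn.
  have [nk' |nk'] := ltnP n (2 ^ k).
    by rewrite Flt// => Px; rewrite SAB; left; exact: PA Px.
  by rewrite Fge// => Qx; rewrite SAB; right; apply: QB Qx; exact: sub_lt.
- move=> n nk; have [nk' |nk'] := ltnP n (2 ^ k).
    by rewrite Flt//; exact: cvP.
  by rewrite Fge//; apply: cvQ; exact: sub_lt.
(* Pieces from different halves have disjoint interiors because [A] and [B] do. *)
- have cross m n x : (m < 2 ^ k)%N -> (n < 2 ^ k.+1)%N -> (2 ^ k <= n)%N ->
      interior (F m) x -> interior (F n) x -> False.
    move=> mk nk nk'; rewrite Flt// Fge// => Px Qx.
    rewrite -[False]/(set0 x) -AB0; split.
      by move: Px; apply: interiorS; exact: PA.
    by move: Qx; apply: interiorS; apply: QB; exact: sub_lt.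
  move=> m n /= mk nk [x [Fm Fn]].
  have [mk' |mk'] := ltnP m (2 ^ k); have [nk' |nk'] := ltnP n (2 ^ k).
  + by apply: tP => //; exists x; move: Fm Fn; rewrite !Flt.
  + by have := cross m n x mk' nk nk' Fm Fn.
  + by have := cross n m x nk' mk mk' Fn Fm.
  + have := tQ (m - 2 ^ k)%N (n - 2 ^ k)%N.
    rewrite /= !sub_lt// => /(_ isT isT) mn.
    suff : (m - 2 ^ k = n - 2 ^ k)%N by lia.
    by apply: mn; exists x; move: Fm Fn; rewrite !Fge.
- move=> n nk; rewrite two_pow ?area_ge0//.
  have [nk' |nk'] := ltnP n (2 ^ k).
    by rewrite Flt// -aP// {1}AB -{1}AB S2A -AB.
  by rewrite Fge// -aQ ?sub_lt// S2A AB.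
(* The bound does not decay: a half's roundness and 1/12 are both at least
   [Num.min (roundness S) (1 / 12)], hence so is their minimum. *)
- move=> n nk; have [nk' |nk'] := ltnP n (2 ^ k).
    rewrite Flt//; apply: le_trans (rP _ nk').
    by rewrite le_min rA ge_min lexx orbT.
  rewrite Fge//; apply: le_trans (rQ _ (sub_lt _ nk nk')).
  by rewrite le_min rB ge_min lexx orbT.
Qed.

(** A sup-norm ball inside [S] is a product of two intervals of positive length. *)
Lemma area_gt0_interior (R : realType) (S : set (R * R)) :
  compact S -> interior S !=set0 -> (0 < area S)%E.
Proof.
move=> cS [[u v] /nbhs_ballP[e /= e0 eS]].
have len (a : R) :
    (0 < lebesgue_measure (ball a e : set (measurableTypeR R)))%E.
  by rewrite lebesgue_measure_ball ?ltW// lte_fin; lra.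
have mb (a : R) : measurable (ball a e : set (measurableTypeR R)).
  exact: measurable_ball.
apply: (@lt_le_trans _ _ (area (ball u e `*` ball v e))).
  by rewrite areaX// mule_gt0.
apply: le_measure; rewrite ?inE; first exact: measurableX.
  exact: compact_measurable_plane.
by move=> [x y] [ux vy]; apply: eS.
Qed.

Theorem theorem1 (R : realType) (S : set (R * R)) (k : nat) :
  plane_convex_body S ->
  exists P : 'I_(2 ^ k) -> set (R * R),
    equal_area_convex_pieces S P /\
    forall i, Num.min (roundness S) (1 / 12) <= roundness (P i).
Proof.
move=> [cS vS iS]; have areaS := area_gt0_interior R S cS iS.
have [P [SP cvP tP aP rP]] := equal_area_cut R k S cS vS areaS.
exists (fun i => P i); split; last by move=> i; exact: rP.
split.
- rewrite {1}SP; apply/seteqP; split=> x [n].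
    by move=> nk Px; exists (Ordinal nk).
  by move=> _ Px; exists n => //=.
- by move=> i; exact: cvP.
- by move=> i j _ _ ij; apply: val_inj; apply: tP => //=.
- move=> i j; have ij := aP i (ltn_ord i); rewrite (aP j (ltn_ord j)) in ij.
  (* Both areas become equal after multiplication by [2 ^+ k], a positive finite factor that can be
     cancelled. *)
  have pow0 : (0 < (2 ^+ k)%:E :> \bar R)%E by rewrite lte_fin exprn_gt0.
  apply/le_anti/andP; split.
    by rewrite -(@lee_pmul2l _ (2 ^+ k)%:E)// -ij.
  by rewrite -(@lee_pmul2l _ (2 ^+ k)%:E)// -ij.
Qed.
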